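(* Let $t\ge 0$ be an integer. Every $t$-spread strongly stable ideal $I\subset K[x_1,\dots,x_n]$ has linear quotients. In particular, every $t$-spread strongly stable ideal is componentwise linear.
   Context: $K$ is a field. A monomial $x_{i_1}x_{i_2}\cdots x_{i_d}$ with $i_1\le i_2\le\cdots\le i_d$ is called $t$-spread if $i_j-i_{j-1}\ge t$ for $2\le j\le d$. A $t$-spread monomial ideal is an ideal generated by $t$-spread monomials. For a monomial $u$, $\operatorname{supp}(u)=\{j : x_j \text{ divides } u\}$. A $t$-spread monomial ideal $I$ is called $t$-spread strongly stable if for all $t$-spread monomials $u\in I$, all $j\in\operatorname{supp}(u)$ and all $i<j$ such that $x_i(u/x_j)$ is $t$-spread, one has $x_i(u/x_j)\in I$. A monomial ideal $I$ has linear quotients if its minimal monomial generators can be ordered $u_1,\dots,u_m$ such that for each $r=2,\dots,m$ the colon ideal $(u_1,\dots,u_{r-1}):u_r$ is generated by a subset of the variables. A graded ideal $I$ is componentwise linear if for every $k$ the ideal $I_{\langle k\rangle}$ generated by all homogeneous elements of degree $k$ in $I$ has a linear resolution. *)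

(* Defs.v *)
From mathcomp Require Import all_boot all_algebra.
From mathcomp.multinomials Require Export mpoly.

Set Implicit Arguments.
Unset Strict Implicit.
Unset Printing Implicit Defensive.

Import GRing.Theory.
Local Open Scope ring_scope.

(* The variables are indexed by 'I_n, i.e. from 0; only differences and
   comparisons of indices matter below. *)

Section Ideals.
Variables (K : fieldType) (n : nat).
Implicit Types (I J G : {mpoly K[n]} -> Prop) (p q : {mpoly K[n]}).

Definition is_ideal I :=
  [/\ I 0, forall p q, I p -> I q -> I (p + q)
    & forall p q, I q -> I (p * q)].

Definition same_ideal I J := forall p, I p <-> J p.

Definition ideal_gen G : {mpoly K[n]} -> Prop := fun p =>
  exists2 s : seq ({mpoly K[n]} * {mpoly K[n]}),
    forall cg, cg \in s -> G cg.2 & p = \sum_(cg <- s) cg.1 * cg.2.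

Definition mon_ideal (M : 'X_{1..n} -> Prop) : {mpoly K[n]} -> Prop :=
  ideal_gen (fun p => exists2 m, M m & p = 'X_[m]).

Definition colon I f : {mpoly K[n]} -> Prop := fun p => I (p * f).

Definition graded_ideal I :=
  is_ideal I /\ forall p d, I p -> I (pihomog mdeg d p).

End Ideals.

Definition tspread (n t : nat) (m : 'X_{1..n}) : Prop :=
  exists2 s : seq 'I_n,
    sorted (fun i j : 'I_n => (i <= j)%N && (t <= j - i)%N) s
    & m = (\sum_(i <- s) U_(i))%MM.

Section StronglyStable.
Variables (K : fieldType) (n : nat).
Implicit Types (I : {mpoly K[n]} -> Prop).

Definition tspread_monomial_ideal (t : nat) I :=
  exists2 M : 'X_{1..n} -> Prop,
    forall m, M m -> tspread t m & same_ideal I (mon_ideal M).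

Definition tspread_strongly_stable (t : nat) I :=
  tspread_monomial_ideal t I /\
  forall u : 'X_{1..n}, tspread t u -> I 'X_[u] ->
  forall j i : 'I_n, (0 < u j)%N -> (i < j)%N ->
    tspread t (U_(i) + (u - U_(j)))%MM ->
    I 'X_[(U_(i) + (u - U_(j)))%MM].

Definition minimal_monomial_generators I (s : seq 'X_{1..n}) :=
  [/\ uniq s, same_ideal I (mon_ideal (fun m => m \in s))
    & forall s' : seq 'X_{1..n}, {subset s' <= s} ->
        same_ideal I (mon_ideal (fun m => m \in s')) -> {subset s <= s'}].

(* The list is indexed from 0: nth r is u_(r+1) and take r is u_1, ..., u_r. *)
Definition has_linear_quotients I :=
  exists2 s : seq 'X_{1..n}, minimal_monomial_generators I s
    & forall r, (0 < r < size s)%N ->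
        exists A : {set 'I_n},
          same_ideal
            (colon (mon_ideal (fun m => m \in take r s)) 'X_[nth 0%MM s r])
            (ideal_gen (fun p : {mpoly K[n]} => exists2 i, i \in A & p = 'X_i)).

(* J has a k-linear resolution over S = K[x_1, ..., x_n], i.e. a graded free
   resolution
     ... -> S(-k-2)^(b 2) -> S(-k-1)^(b 1) -> S(-k)^(b 0) -> J -> 0.
   Elements of S^(b i) are row vectors and maps act by right multiplication.
   Homogeneity of degree 0 of the augmentation (resp. of the differentials)
   says that the entries of eps (resp. d i) are homogeneous of degree k
   (resp. 1), the zero polynomial being homogeneous of every degree; such a
   resolution is minimal, since linear forms lie in the irrelevant ideal.
   Ranks may be 0, so J = 0 and finite resolutions are covered. *)
Definition has_linear_resolution (k : nat) (J : {mpoly K[n]} -> Prop) :=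
  exists (b : nat -> nat)
         (eps : 'cV[{mpoly K[n]}]_(b 0%N))
         (d : forall i, 'M[{mpoly K[n]}]_(b i.+1, b i)),
    [/\ forall a, eps a 0 \is k.-homog,
        forall i a c, d i a c \is 1.-homog,
        forall p, J p <-> exists v : 'rV_(b 0%N), p = (v *m eps) 0 0,
        forall v : 'rV_(b 0%N),
          v *m eps = 0 <-> exists w : 'rV_(b 1%N), v = w *m d 0%N
      & forall i (v : 'rV_(b i.+1)),
          v *m d i = 0 <-> exists w : 'rV_(b i.+2), v = w *m d i.+1].

Definition degree_component (k : nat) I : {mpoly K[n]} -> Prop :=
  ideal_gen (fun p => I p /\ p \is k.-homog).

Definition componentwise_linear I :=
  graded_ideal I /\ forall k, has_linear_resolution k (degree_component k I).

End StronglyStable.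

(* Main.v *)
(* Order the minimal generators by increasing degree and, within a degree, from
   the lexicographically largest down.  If u precedes w, compare their sorted
   index words i_1 <= i_2 <= ... and j_1 <= j_2 <= ... at the first s with
   i_s < j_s: such an s exists, for otherwise a prefix of w could be obtained
   from u by stable moves, against the minimality of w or the order.  Then x_(i_s)
   divides u / gcd(u, w), and x_(i_s) w / x_(j_s) is a t-spread monomial of I, a
   minimal generator of which precedes w.

   The monomials of degree k in I, sorted by the first generator dividing them,
   then again have linear quotients.  Adjoining these monomials w one at a time,
   the mapping cone of a resolution of the colon ideal by w over a linear
   resolution of the previous ideal is linear.  The colon ideals are generated by
   variables; their (Koszul) resolutions come from the same mapping cones. *)
Require Import Defs.
From mathcomp Require Import all_boot all_algebra.
From mathcomp Require Import order.
From Stdlib Require Import ClassicalEpsilon.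

Set Implicit Arguments.
Unset Strict Implicit.
Unset Printing Implicit Defensive.

Import Order.TTheory GRing.Theory.
Local Open Scope ring_scope.

(** * Resolutions by matrices of linear forms; mapping cones *)

Section LinearResolutions.
Variables (K : fieldType) (n : nat).
Local Notation S := {mpoly K[n]}.

Definition mxhomog (k : nat) m p (M : 'M[S]_(m, p)) :=
  forall i j, M i j \is k.-homog.

Definition mxexact m p r (N : 'M[S]_(r, m)) (M : 'M[S]_(m, p)) :=
  forall v : 'rV_m, v *m M = 0 <-> exists w : 'rV_r, v = w *m N.

(** Coinductive, so that resolutions can be built by corecursion. The entries of [M] may have any
    degree, so [M] may be the augmentation. *)
CoInductive linres m p (M : 'M[S]_(m, p)) : Prop :=
  Linres m' (M' : 'M[S]_(m', m)) of mxhomog 1 M' & mxexact M' M & linres M'.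

Lemma linres0 p (M : 'M[S]_(0, p)) : linres M.
Proof.
move: p M; cofix IH => p M; apply: (@Linres _ _ _ 0%N 0) => //; first by case.
move=> v; split=> _; last by rewrite [v]thinmx0 mul0mx.
by exists 0; rewrite mulmx0 [v]thinmx0.
Qed.

Lemma pihomogM (k d : nat) (p q : S) :
  q \is k.-homog -> pihomog mdeg (d + k) (p * q) = pihomog mdeg d p * q.
Proof.
move=> hq; elim/mpolyind: p => [|c m p _ _ IH].
  by rewrite mul0r !pihomog0 mul0r.
rewrite mulrDl !pihomogD IH mulrDl; congr (_ + _).
rewrite -scalerAl !linearZ /= -scalerAl; congr (_ *: _).
have hm : 'X_[m] * q \is (mdeg m + k).-homog by apply: dhomogM; rewrite ?dhomogX.
rewrite pihomogX; case: (eqVneq (mdeg m) d) hm => [-> hm|ne hm].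
  by rewrite pihomog_dE.
by rewrite mul0r (pihomog_ne0 _ hm) // eqn_add2r.
Qed.

(** Lift each row, then keep only the degree [d] part of its entries: the equation survives since
    [M] and [N] are homogeneous. *)
Lemma mxhomog_lift (k d m p r : nat) (M : 'M[S]_(m, p)) (N : 'M[S]_(r, p)) :
  mxhomog k M -> mxhomog (d + k) N ->
  (forall v : 'rV_r, exists u : 'rV_m, v *m N = u *m M) ->
  exists2 U : 'M_(r, m), mxhomog d U & N = U *m M.
Proof.
move=> hM hN lift.
have /fin_all_exists [u hu] (i : 'I_r) : exists u : 'rV_m, row i N = u *m M.
  by rewrite rowE.
exists (\matrix_(i, j) pihomog mdeg d (u i 0 j)) => [i j|].
  by rewrite mxE pihomogP.
apply/matrixP=> i j; move/rowP/(_ j): (hu i); rewrite !mxE => hij.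
rewrite -(pihomog_dE (hN i j)) hij raddf_sum /=.
by apply: eq_bigr => l _; rewrite mxE pihomogM.
Qed.

Lemma mxexact_mul0 m p r (N : 'M[S]_(r, m)) (M : 'M[S]_(m, p)) :
  mxexact N M -> N *m M = 0.
Proof.
move=> ex; apply/row_matrixP=> i; rewrite row_mul row0; apply/ex.
by exists (delta_mx 0 i); rewrite -rowE.
Qed.

Lemma mxhomog_block0 k m p m2 p2 (M : 'M[S]_(m, p)) (N : 'M[S]_(m2, p2))
    (H : 'M[S]_(m2, p)) :
  mxhomog k M -> mxhomog k H -> mxhomog k N -> mxhomog k (block_mx M 0 H N).
Proof.
move=> hM hH hN i j; rewrite -(splitK i) -(splitK j).
case: (split i) => i'; case: (split j) => j' /=;
  by rewrite ?block_mxEul ?block_mxEur ?block_mxEdl ?block_mxEdr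
    ?mxE //; apply: dhomog0.
Qed.

(** [U] is minus a linear lift of [N1 *m H] through [M], which makes the block matrices compose to
    0. The last conclusion is the lifting hypothesis for the next step. *)
Lemma block_exact m p m1 m2 p2 q1 (M : 'M[S]_(m, p)) (N : 'M[S]_(m2, p2))
    (H : 'M[S]_(m2, p)) (M1 : 'M[S]_(m1, m)) (N1 : 'M[S]_(q1, m2)) :
  mxhomog 1 M -> mxhomog 1 H -> mxhomog 1 N1 -> mxexact M1 M -> mxexact N1 N ->
  (forall v : 'rV_m2, v *m N = 0 -> exists u : 'rV_m, v *m H = u *m M) ->
  exists U : 'M_(q1, m),
    [/\ mxhomog 1 U, mxexact (block_mx M1 0 U N1) (block_mx M 0 H N)
      & forall v : 'rV_q1, v *m N1 = 0 -> exists u : 'rV_m1, v *m U = u *m M1].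
Proof.
move=> hM hH hN1 exM exN lift.
have [|v|U hU defU] := @mxhomog_lift 1 1 _ _ _ M (N1 *m H) hM.
- move=> i j; rewrite mxE; apply: rpred_sum => l _; exact: (dhomogM (hN1 i l)).
- by rewrite mulmxA; apply: lift; apply/exN; exists v.
exists (- U); split=> [i j|v|v e].
- by rewrite mxE dhomogN.
- rewrite -[v]hsubmxK mul_row_block mulmx0 add0r.
  set v1 := lsubmx v; set v2 := rsubmx v; split.
    rewrite -row_mx0 => /eq_row_mx [e1 /exN [z e2]].
    have /exM [w e] : (v1 + z *m U) *m M = 0.
      by rewrite mulmxDl -mulmxA -defU mulmxA -e2.
    exists (row_mx w z); rewrite mul_row_block mulmx0 add0r -e -e2.
    by rewrite mulmxN addrK.
  case=> w; rewrite -[w]hsubmxK mul_row_block mulmx0 add0r => /eq_row_mx [-> ->].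
  rewrite mulmxN mulmxDl mulNmx -!mulmxA -defU subrK.
  by rewrite (mxexact_mul0 exM) (mxexact_mul0 exN) !mulmx0 row_mx0.
have /exM [u eu] : (v *m U) *m M = 0 by rewrite -mulmxA -defU mulmxA e mul0mx.
by exists (- u); rewrite mulmxN eu mulNmx.
Qed.

(* The horseshoe lemma: the resolution of the block matrix is built by
   lifting the lower left block again and again. *)
Lemma linres_block m p m2 p2 (M : 'M[S]_(m, p)) (N : 'M[S]_(m2, p2))
    (H : 'M[S]_(m2, p)) :
  mxhomog 1 M -> mxhomog 1 H -> linres M -> linres N ->
  (forall v : 'rV_m2, v *m N = 0 -> exists u : 'rV_m, v *m H = u *m M) ->
  linres (block_mx M 0 H N).
Proof.
move: m p m2 p2 M N H; cofix IH => m p m2 p2 M N H hM hH resM resN lift.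
destruct resM as [m1 M1 hM1 exM resM1], resN as [q1 N1 hN1 exN resN1].
destruct (block_exact hM hH hN1 exM exN lift) as [U [hU exU liftU]].
exact (Linres (mxhomog_block0 hM1 hU hN1) exU
  (IH _ _ _ _ _ _ _ hM1 hU resM1 resN1 liftU)).
Qed.

Lemma linres_cone k m a (eps : 'cV[S]_m) (f : S) (kap : 'cV[S]_a) :
  mxhomog k eps -> f \is k.-homog -> mxhomog 1 kap ->
  linres eps -> linres kap ->
  (forall p, (exists v : 'rV_m, p * f = (v *m eps) 0 0) <->
             (exists v : 'rV_a, p = (v *m kap) 0 0)) ->
  linres (col_mx eps f%:M).
Proof.
move=> heps hf hkap [m1 M1 hM1 exM resM] reskap colon.
have [|v|H hH defH] := @mxhomog_lift k 1 _ _ _ eps (f *: kap) heps.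
- by move=> i j; rewrite mxE mulrC; apply: dhomogM.
- have [_ /(_ (ex_intro _ v erefl)) [u e]] := colon ((v *m kap) 0 0).
  exists u; apply/rowP=> j; rewrite ord1 -e -scalemxAr mxE mulrC //.
have fE (p : 'M_1) : p *m f%:M = f *: p.
  by rewrite -scalemx1 -scalemxAr mulmx1.
apply: (@Linres _ _ _ _ (block_mx M1 0 (- H) kap)).
- by apply: mxhomog_block0 => // i j; rewrite mxE dhomogN.
- move=> v; rewrite -[v]hsubmxK mul_row_col fE.
  set v1 := lsubmx v; set v2 := rsubmx v; split.
    move=> e.
    have [colon1 _] := colon (v2 0 0); have [|z ez] := colon1.
      exists (- v1); rewrite mulNmx.
      by move/eqP: e; rewrite addr_eq0 => /eqP ->; rewrite opprK [RHS]mxE mulrC.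
    have {}ez : v2 = z *m kap by apply/rowP=> j; rewrite ord1.
    have /exM [w ew] : (v1 + z *m H) *m eps = 0.
      by rewrite mulmxDl -mulmxA -defH -scalemxAr -ez.
    exists (row_mx w z); rewrite mul_row_block mulmx0 add0r -ew -ez.
    by rewrite mulmxN addrK.
  case=> w; rewrite -[w]hsubmxK mul_row_block mulmx0 add0r => /eq_row_mx [-> ->].
  rewrite mulmxN mulmxDl mulNmx -!mulmxA -defH scalemxAr subrK.
  by rewrite (mxexact_mul0 exM) mulmx0.
apply: linres_block => //; first by move=> i j; rewrite mxE dhomogN.
move=> v e.
have /exM [u eu] : (v *m H) *m eps = 0.
  by rewrite -mulmxA -defH -scalemxAr e scaler0.
by exists (- u); rewrite mulmxN eu mulNmx.
Qed.

Record linmap := Linmap {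
  lm_src : nat; lm_tgt : nat; lm_mx : 'M[S]_(lm_src, lm_tgt);
  lm_res : linres lm_mx }.

(** Choice: [linres] only asserts that a next matrix exists, while [has_linear_resolution] asks for
    the whole sequence. *)
Lemma linres_next m p (M : 'M[S]_(m, p)) : linres M ->
  {N : {m' : nat & 'M[S]_(m', m)} |
    [/\ mxhomog 1 (tagged N), mxexact (tagged N) M & linres (tagged N)]}.
Proof.
by move=> res; apply: constructive_indefinite_description; case: res => m' M' *;
  exists (Tagged (fun m' => 'M[S]_(m', m)) M').
Qed.

(* Built with projections rather than by matching on [L], so that
   [lm_tgt (lm_next L)] reduces to [lm_src L] for an arbitrary [L]. *)
Definition lm_next (L : linmap) : linmap :=
  Linmap (let: And3 _ _ res := svalP (linres_next (lm_res L)) in res).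

Lemma linres_linear_resolution k m (eps : 'cV[S]_m) (J : S -> Prop) :
  mxhomog k eps -> linres eps ->
  (forall p, J p <-> exists v : 'rV_m, p = (v *m eps) 0 0) ->
  has_linear_resolution k J.
Proof.
move=> heps res hJ.
(* [L 0] is the augmentation, so the differential [d i] is the matrix of [L i.+1]. *)
pose L i := iter i lm_next (Linmap res).
exists (fun i => lm_src (L i)), eps, (fun i => lm_mx (L i.+1)).
have nextP i := svalP (linres_next (lm_res (L i))).
split.
- by move=> a; apply: heps.
- by move=> i; case: (nextP i).
- exact: hJ.
- by case: (nextP 0%N).
- by move=> i; case: (nextP i.+1).
Qed.

End LinearResolutions.

(** * Linear quotients in terms of exponents; orders on monomials *)

Section LinearQuotients.
Variable n : nat.
Implicit Types (u v w m : 'X_{1..n}) (s : seq 'X_{1..n}).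

(* The colon ideal (s) : w is generated by variables, read off exponents: some
   variable in the colon ideal divides u / gcd(u, w). *)
Definition linquot s w :=
  forall u, u \in s ->
    exists2 l : 'I_n, (w l < u l)%N & has (fun v => (v <= U_(l) + w)%MM) s.

Definition linquots s := forall r, (r < size s)%N -> linquot (take r s) (nth 0%MM s r).

Lemma linquots_rcons s w : linquots (rcons s w) -> linquots s /\ linquot s w.
Proof.
move=> lq; split=> [r lt_r|].
  have : (r < size (rcons s w))%N by rewrite size_rcons ltnW.
  by move/lq; rewrite nth_rcons lt_r -cats1 takel_cat // ltnW.
have : (size s < size (rcons s w))%N by rewrite size_rcons.
by move/lq; rewrite nth_rcons ltnn eqxx -cats1 take_size_cat.
Qed.

(** The key [f] is [mdeg] for the generators and [first_div s] for the monomials of one degree.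
    Either way, ties are between monomials of equal degree, where the monomial order is
    lexicographic. *)
Definition keylt (f : 'X_{1..n} -> nat) u w :=
  (f u < f w)%N || (f u == f w) && (w < u)%O.

Definition keyle f u w := (u == w) || keylt f u w.

Lemma keyle_total f : total (keyle f).
Proof.
move=> u w; rewrite /keyle /keylt; case: (ltngtP (f u) (f w)) => //=.
- by rewrite orbT.
- by rewrite !orbT.
by case: (ltgtP u w); rewrite ?orbT // => ->.
Qed.

Lemma keyle_trans f : transitive (keyle f).
Proof.
move=> v u w /predU1P [->//|uv] /predU1P [<-|vw].
  by rewrite /keyle uv orbT.
apply/orP; right; move: uv vw; rewrite /keylt.
case/orP=> [uv|/andP [/eqP uv lt_vu]] /orP [vw|/andP [/eqP vw lt_wv]].
- by rewrite (ltn_trans uv vw).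
- by rewrite -vw uv.
- by rewrite uv vw.
- by rewrite uv vw eqxx (lt_trans lt_wv lt_vu) orbT.
Qed.

Lemma keylt_asym f u w : keylt f u w -> ~~ keyle f w u.
Proof.
rewrite /keyle /keylt; case: (ltngtP (f u) (f w)) => //= [lt_f _|_].
  by rewrite orbF; apply: contraTneq lt_f => ->; rewrite ltnn.
by case: ltgtP.
Qed.

Section Sorted.
Variables (f : 'X_{1..n} -> nat) (s : seq 'X_{1..n}).
Hypotheses (s_uniq : uniq s) (s_sorted : sorted (keyle f) s).

Lemma mem_take_keylt r u : (r < size s)%N -> u \in s ->
  (u \in take r s) = keylt f u (nth 0%MM s r).
Proof.
move=> lt_r us; rewrite in_take //.
have le_nth := sorted_leq_nth (@keyle_trans f) (fun v => predU1l _ (erefl v)) 0%MM s_sorted.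
have iu : (index u s < size s)%N by rewrite index_mem.
rewrite -{2}(nth_index 0%MM us); case: ltnP => [lt_i|le_i].
  case/predU1P: (le_nth _ _ iu lt_r (ltnW lt_i)) => // /eqP.
  by rewrite nth_uniq // ltn_eqF.
by apply/esym; apply: contraTF (le_nth _ _ lt_r iu le_i); apply: keylt_asym.
Qed.
End Sorted.

End LinearQuotients.

(** * Membership in monomial ideals and their colon ideals *)

Section MonomialIdeals.
Variables (K : fieldType) (n : nat).
Local Notation S := {mpoly K[n]}.
Implicit Types (p q : S) (u v w m : 'X_{1..n}) (s : seq 'X_{1..n}) (M : 'X_{1..n} -> Prop).

Lemma ideal_gen_ideal (G : S -> Prop) : is_ideal (ideal_gen G).
Proof.
split.
- by exists [::]; rewrite ?big_nil.
- move=> _ _ [s1 h1 ->] [s2 h2 ->]; exists (s1 ++ s2); last by rewrite big_cat.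
  by move=> cg; rewrite mem_cat => /orP [/h1|/h2].
move=> p _ [s h ->]; exists [seq (p * cg.1, cg.2) | cg <- s].
  by move=> _ /mapP [cg /h hcg ->].
by rewrite big_map mulr_sumr; apply: eq_bigr => cg _; rewrite mulrA.
Qed.

Lemma ideal_gen_sub (G : S -> Prop) p : G p -> ideal_gen G p.
Proof.
move=> hp; exists [:: (1, p)]; last by rewrite big_seq1 mul1r.
by move=> cg; rewrite inE => /eqP ->.
Qed.

Lemma ideal_gen_min (G I : S -> Prop) : is_ideal I ->
  (forall p, G p -> I p) -> forall p, ideal_gen G p -> I p.
Proof.
case=> I0 ID IM sub _ [s h ->]; rewrite big_seq.
by elim/big_ind: _ => // cg /h /sub /IM.
Qed.

Lemma mon_idealP M p :
  mon_ideal M p <-> forall m, m \in msupp p -> exists2 u, M u & (u <= m)%MM.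
Proof.
split=> [[s h ->] m /msupp_sum_le /flattenP [_ /mapP [cg + ->]]|sub].
  rewrite mem_filter /= => /h [u Mu ->] /msuppM_le /allpairsP [[m1 m2] /= [_]].
  by rewrite msuppX inE => /eqP -> ->; exists u; rewrite // lem_addl.
have [I0 ID IM] := ideal_gen_ideal (fun p => exists2 m, M m & p = 'X_[m] :> S).
rewrite (mpolyE p) big_seq; elim/big_ind: _ => // m /sub [u Mu le_um].
rewrite -(submK le_um) mpolyXD scalerAl; apply: IM.
by apply: ideal_gen_sub; exists u.
Qed.

Lemma mon_idealX M m : mon_ideal M ('X_[m] : S) <-> exists2 u, M u & (u <= m)%MM.
Proof.
rewrite mon_idealP msuppX; split=> [|h m']; first by apply; rewrite inE.
by rewrite inE => /eqP ->.
Qed.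

Lemma colon_mon_ideal M w p :
  colon (mon_ideal M) 'X_[w] p <->
  forall m, m \in msupp p -> exists2 u, M u & (u <= m + w)%MM.
Proof.
rewrite /colon mon_idealP; split=> h m.
  by move=> hm; apply: h; rewrite (perm_mem (msuppMX _ _)) addmC map_f.
by rewrite (perm_mem (msuppMX _ _)) => /mapP [m' /h hm ->]; rewrite addmC.
Qed.

(** [u <= m + w] and [w l < u l] force [0 < m l], so a variable of the colon ideal divides [m]. *)
Lemma linquot_colon s w p : linquot s w ->
  colon (mon_ideal (fun m => m \in s)) ('X_[w] : S) p <->
  mon_ideal (fun m => m \in [seq U_(l)%MM | l <- enum 'I_n &
                               has (fun v => (v <= U_(l) + w)%MM) s]) p.
Proof.
move=> lq; rewrite colon_mon_ideal mon_idealP; split=> h m /h [u us le_u].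
  have [l lt_l hl] := lq u us; exists U_(l)%MM.
    by rewrite map_f // mem_filter hl mem_enum.
  move/mnm_lepP/(_ l): le_u; rewrite mnmDE lep1mP => le_u.
  by apply: contraTneq lt_l => m0; rewrite -leqNgt -[w l]add0n -m0.
case/mapP: us le_u => l; rewrite mem_filter => /andP [/hasP [v vs le_v] _] -> le_l.
exists v => //; apply: lepm_trans le_v _.
by apply/mnm_lepP=> i; rewrite !mnmDE leq_add2r; apply/mnm_lepP.
Qed.

End MonomialIdeals.

(** * From linear quotients in one degree to linear resolutions *)

Section LinearGenerators.
Variables (K : fieldType) (n : nat).
Local Notation S := {mpoly K[n]}.
Implicit Types (p q : S) (u v w m : 'X_{1..n}) (s : seq 'X_{1..n}).

Lemma mon_ideal_rcons s w p :
  mon_ideal (fun m => m \in rcons s w) p <->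
  exists q c, mon_ideal (fun m => m \in s) q /\ p = q + c * 'X_[w].
Proof.
have [I0 ID IM] := ideal_gen_ideal (fun p => exists2 m, m \in s & p = 'X_[m] :> S).
have [J0 JD JM] :=
  ideal_gen_ideal (fun p => exists2 m, m \in rcons s w & p = 'X_[m] :> S).
split=> [|[q [c [hq ->]]]].
  pose I p := exists q c, mon_ideal (fun m => m \in s) q /\ p = q + c * 'X_[w] :> S.
  apply: (ideal_gen_min (I := I)) => [|_ [m hm ->]].
    split; first by exists 0, 0; rewrite mul0r addr0.
      move=> _ _ [q1 [c1 [h1 ->]]] [q2 [c2 [h2 ->]]].
      by exists (q1 + q2), (c1 + c2); rewrite mulrDl addrACA; split=> //; apply: ID.
    move=> r _ [q [c [h ->]]]; exists (r * q), (r * c).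
    by rewrite mulrDr mulrA; split=> //; apply: IM.
  move: hm; rewrite mem_rcons inE => /predU1P [->|ms].
    by exists 0, 1; rewrite mul1r add0r.
  by exists 'X_[m], 0; rewrite mul0r addr0; split=> //; apply: ideal_gen_sub; exists m.
apply: JD; last first.
  by apply: JM; apply: ideal_gen_sub; exists w; rewrite // mem_rcons mem_head.
apply/mon_idealP=> m; move/mon_idealP: hq => /[apply] -[u us le_u].
by exists u; rewrite // mem_rcons inE us orbT.
Qed.

Definition lin_gens k s :=
  exists N (eps : 'cV[S]_N), [/\ mxhomog k eps, linres eps
    & forall p, mon_ideal (fun m => m \in s) p <->
                exists v : 'rV_N, p = (v *m eps) 0 0].

Lemma lin_gens_nil k : lin_gens k [::].
Proof.
exists 0%N, 0; split=> [[]//||p]; first exact: linres0.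
rewrite mon_idealP; split=> [h|[v ->] m]; last by rewrite mulmx0 mxE msupp0.
exists 0; rewrite mulmx0 mxE; apply: msuppnil0.
by case: (msupp p) h => // m r /(_ m (mem_head _ _)) [].
Qed.

Lemma lin_gens_rcons k s w t : mdeg w = k -> lin_gens k s -> lin_gens 1 t ->
  (forall p, colon (mon_ideal (fun m => m \in s)) ('X_[w] : S) p <->
             mon_ideal (fun m => m \in t) p) ->
  lin_gens k (rcons s w).
Proof.
move=> deg_w [N [eps [heps res genS]]] [a [kap [hkap resk genT]]] colon_s.
have hw : ('X_[w] : S) \is k.-homog by rewrite dhomogX; apply/eqP.
exists (N + 1)%N, (col_mx eps 'X_[w]%:M); split=> [i j||p].
- rewrite -(splitK i); case: (split i) => i' /=; rewrite ?col_mxEu ?col_mxEd //.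
  by rewrite !ord1 mxE.
- by apply: (linres_cone heps hw hkap) => // p; rewrite -genT -colon_s -genS.
have wE (p' : 'M[S]_1) : p' *m 'X_[w]%:M = 'X_[w] *: p'.
  by rewrite -scalemx1 -scalemxAr mulmx1.
rewrite mon_ideal_rcons; split=> [[q [c [/genS [v ->] ->]]]|[v ->]].
  by exists (row_mx v c%:M); rewrite mul_row_col wE !mxE eqxx mulrC.
rewrite -[v]hsubmxK mul_row_col wE mxE.
exists ((lsubmx v *m eps) 0 0), (rsubmx v 0 0); split.
  by apply/genS; exists (lsubmx v).
by congr (_ + _); rewrite [LHS]mxE mulrC.
Qed.

(** For [a] outside [A], the colon of the ideal of [A] by [x_a] is that same ideal, so the induction
    hypothesis serves twice. *)
Lemma lin_gens_vars (A : seq 'I_n) : uniq A -> lin_gens 1 [seq U_(l)%MM | l <- A].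
Proof.
elim/last_ind: A => [|A a IH]; first by move=> _; apply: lin_gens_nil.
rewrite rcons_uniq map_rcons => /andP [aA /IH {}IH].
apply: (lin_gens_rcons _ IH IH) => [|p]; first exact: mdeg1.
rewrite colon_mon_ideal mon_idealP; split=> h m /h [_ /mapP [l lA ->]].
  rewrite lep1mP mnmDE mnm1E => le_l; exists U_(l)%MM; first by rewrite map_f.
  by rewrite lep1mP; case: (eqVneq a l) le_l aA => [->|]; rewrite ?lA ?addn0.
by exists U_(l)%MM; rewrite ?map_f // (lepm_trans _ (lem_addr _ _)).
Qed.

Lemma linquots_lin_gens k s : (forall w, w \in s -> mdeg w = k) -> linquots s ->
  lin_gens k s.
Proof.
elim/last_ind: s => [|s w IH] deg_s; first by move=> _; apply: lin_gens_nil.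
case/linquots_rcons => /IH {}IH lq.
apply: (lin_gens_rcons _ (IH _) _ (fun p => linquot_colon p lq)).
- by apply: deg_s; rewrite mem_rcons mem_head.
- by move=> u us; apply: deg_s; rewrite mem_rcons inE us orbT.
- by apply: lin_gens_vars; apply: filter_uniq (enum_uniq _).
Qed.

End LinearGenerators.

(** * Linear quotients for the monomials of a fixed degree *)

Section Componentwise.
Variable n : nat.
Implicit Types (u v w m : 'X_{1..n}) (s : seq 'X_{1..n}).

Definition divby s m := has (fun u => (u <= m)%MM) s.

Definition first_div s m := find (fun u => (u <= m)%MM) s.

Definition degree_part k s : seq 'X_{1..n} :=
  sort (keyle (first_div s))
    [seq bmnm b | b <- enum [pred m : 'X_{1..n < k.+1} | (mdeg m == k) && divby s m]].

Lemma mem_degree_part k s m : (m \in degree_part k s) = (mdeg m == k) && divby s m.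
Proof.
rewrite mem_sort; apply/mapP/idP => [[m']|hm]; first by rewrite mem_enum => + ->.
have lt_m : (mdeg m < k.+1)%N by case/andP: hm => /eqP ->.
by exists (BMultinom lt_m); rewrite // mem_enum.
Qed.

Lemma degree_part_uniq k s : uniq (degree_part k s).
Proof. by rewrite sort_uniq map_inj_uniq ?enum_uniq //; apply: val_inj. Qed.

Lemma first_div_take s m r : (r <= size s)%N ->
  (first_div s m < r)%N = divby (take r s) m.
Proof.
move=> le_r; rewrite /first_div -{1}(cat_take_drop r s) find_cat -/(divby _ _).
case: ifP => h; last by rewrite size_takel // ltnNge leq_addr.
by move: h; rewrite /divby has_find size_takel.
Qed.

(** [l] is the first place where the exponents differ; as the degrees agree, [w] exceeds [u]
    somewhere, necessarily after [l]. *)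
Lemma mnm_gt_witness u w : mdeg u = mdeg w -> (w < u)%O ->
  exists l j : 'I_n, [/\ (l < j)%N, (w l < u l)%N & (u j < w j)%N].
Proof.
move=> eq_deg /(ltmcP (esym eq_deg)) [l eq_l lt_l].
case: (pickP [pred j | u j < w j]%N) => [j /= lt_j|le_wu].
  exists l, j; split=> //; rewrite ltnNge leq_eqVlt; apply/negP.
  case/predU1P=> [/val_inj e|/eq_l e]; last by rewrite e ltnn in lt_j.
  by rewrite e ltnNge (ltnW lt_l) in lt_j.
move/eqP: eq_deg; rewrite !mdegE gtn_eqF // (bigD1 l) //= [X in (_ < X)%N](bigD1 l) //=.
by rewrite -addSn leq_add // leq_sum // => i _; rewrite leqNgt; apply/negbT/le_wu.
Qed.

Lemma exchange_gt m (i j : 'I_n) : (0 < m j)%N -> (i < j)%N ->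
  (m < (U_(i) + (m - U_(j)))%MM)%O.
Proof.
move=> m_j lt_ij.
have e : (m - U_(j) + U_(j))%MM = m by rewrite submK // lep1mP -lt0n.
rewrite -{1}e addmC ltmc_add2l.
apply/ltmcP; rewrite ?mdeg1 //; exists i; last by rewrite !mnm1E eqxx -val_eqE gtn_eqF.
by move=> l lt_l; rewrite !mnm1E -!val_eqE !gtn_eqF // (ltn_trans lt_l).
Qed.

Lemma mdeg_exchange m (i j : 'I_n) : (0 < m j)%N ->
  mdeg (U_(i) + (m - U_(j)))%MM = mdeg m.
Proof.
move=> m_j; have e : (m - U_(j) + U_(j))%MM = m by rewrite submK // lep1mP -lt0n.
by rewrite -{2}e !mdegD !mdeg1 addnC.
Qed.

(** Let [a] be the first generator dividing [w]. If [u] has an earlier first divisor, the linear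
    quotients of [s] at [a] supply [l]; if it is also [a], a lexicographic exchange does. *)
Lemma degree_part_linquots k s : linquots s ->
  (forall r, (r < size s)%N ->
     forall u, u \in take r s -> (mdeg u <= mdeg (nth 0%MM s r))%N) ->
  linquots (degree_part k s).
Proof.
move=> lq mono r lt_r; set L := degree_part k s.
have sorted_L : sorted (keyle (first_div s)) L by apply: sort_sorted; apply: keyle_total.
have take_L := mem_take_keylt (degree_part_uniq k s) sorted_L lt_r.
set w := nth _ _ _ in take_L *.
have wL : w \in L by apply: mem_nth.
have /andP [/eqP deg_w div_w] : (mdeg w == k) && divby s w by rewrite -mem_degree_part.
have earlier (l : 'I_n) v : v \in L -> keylt (first_div s) v w ->
    (v <= U_(l) + w)%MM -> has (fun v => (v <= U_(l) + w)%MM) (take r L).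
  by move=> vL lt_v le_v; apply/hasP; exists v; rewrite // take_L.
move=> u uT; have uL := mem_take uT; move: uT; rewrite take_L //.
have /andP [/eqP deg_u div_u] : (mdeg u == k) && divby s u by rewrite -mem_degree_part.
set q := first_div s w.
have lt_q : (q < size s)%N by rewrite -has_find.
set a := nth 0%MM s q; have le_a : (a <= w)%MM by apply: (@nth_find _ _ (fun u => (u <= w)%MM)).
case/orP=> [lt_f|/andP [/eqP eq_f gt_u]].
  set b := nth 0%MM s (first_div s u).
  have le_b : (b <= u)%MM by apply: (@nth_find _ _ (fun v => (v <= u)%MM)).
  have b_take : b \in take q s.
    have lt_p : (first_div s u < size s)%N by apply: ltn_trans lt_f lt_q.
    by rewrite in_take ?mem_nth // (leq_ltn_trans (index_nth _ lt_p)).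
  have [l lt_l /hasP [b' b'_take le_b']] := lq q lt_q b b_take.
  (* If [a l < w l], then [x_l a], hence [b'], would divide [w], although [b'] comes before [a]. *)
  have w_l : (w l <= a l)%N.
    rewrite leqNgt; apply/negP => lt_al.
    suff: (q < q)%N by rewrite ltnn.
    rewrite {1}/q first_div_take ?(ltnW lt_q) //; apply/hasP; exists b' => //.
    apply: lepm_trans le_b' _; apply/mnm_lepP=> i; rewrite mnmDE mnm1E.
    by case: eqP => [<-|_] //; move/mnm_lepP: le_a; apply.
  exists l; first by rewrite (leq_ltn_trans w_l) // (leq_trans lt_l) //; apply/mnm_lepP.
  have le_b'w : (b' <= U_(l) + w)%MM.
    apply: lepm_trans le_b' _; apply/mnm_lepP=> i; rewrite !mnmDE leq_add2l.
    exact/mnm_lepP.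
  have [j lt_j] : exists j, (b' j < (U_(l) + w)%MM j)%N.
    apply/existsP; apply: contraTT (mono q lt_q b' b'_take) => /existsPn ge_b'.
    have : (mdeg (U_(l) + w)%MM <= mdeg b')%N.
      by rewrite !mdegE leq_sum // => i _; rewrite leqNgt.
    rewrite mdegD mdeg1 add1n -ltnNge; apply: leq_ltn_trans.
    by rewrite !mdegE leq_sum // => i _; apply/mnm_lepP.
  pose v := (U_(l) + w - U_(j))%MM.
  have e : (v + U_(j))%MM = (U_(l) + w)%MM by rewrite submK // lep1mP -lt0n (leq_ltn_trans _ lt_j).
  have le_b'v : (b' <= v)%MM.
    apply/mnm_lepP=> i; rewrite /v mnmBE mnm1E.
    case: eqP => [<-|_]; first by rewrite leq_subRL ?add1n // (leq_ltn_trans _ lt_j).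
    by rewrite subn0; apply/mnm_lepP.
  have deg_v : mdeg v = k.
    by apply/eqP; rewrite -(eqn_add2r 1) -{1}(mdeg1 j) -mdegD e mdegD mdeg1 deg_w addnC.
  apply: (earlier l v); last by rewrite -e lem_addr.
    by rewrite mem_degree_part deg_v eqxx; apply/hasP; exists b' => //; apply: mem_take b'_take.
  rewrite /keylt first_div_take ?(ltnW lt_q) //.
  by apply/orP; left; apply/hasP; exists b'.
have [|l [j [lt_lj lt_l lt_j]]] := mnm_gt_witness _ gt_u; first by rewrite deg_u.
exists l => //; pose v := (U_(l) + (w - U_(j)))%MM.
have w_j : (0 < w j)%N by apply: leq_ltn_trans lt_j.
(* The exponent at [j] drops by one, but [a] also divides [u], so [a j <= u j < w j]. *)
have le_av : (a <= v)%MM.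
  apply/mnm_lepP=> i; rewrite /v mnmDE mnmBE !mnm1E.
  case: (eqVneq j i) => [<-|_]; last first.
    by rewrite subn0 (leq_trans _ (leq_addl _ _)) //; apply/mnm_lepP.
  rewrite -val_eqE ltn_eqF // add0n leq_subRL // add1n; apply: leq_ltn_trans lt_j.
  move: (nth_find 0%MM div_u); rewrite -/(first_div s u) eq_f => /mnm_lepP; exact.
have div_v : has (fun u => (u <= v)%MM) (take q.+1 s).
  apply/hasP; exists a => //.
  by rewrite in_take ?mem_nth // ltnS index_nth.
apply: (earlier l v).
- rewrite mem_degree_part mdeg_exchange // deg_w eqxx.
  by case/hasP: div_v => c /mem_take cs le_c; apply/hasP; exists c.
(* The first divisor of [v] has index at most [q]; if it is [q], then [v] precedes [w] by being
   larger. *)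
- rewrite /keylt -/q exchange_gt // andbT orbC -leq_eqVlt -ltnS first_div_take //.
by apply/mnm_lepP=> i; rewrite !mnmDE leq_add2l mnmBE leq_subr.
Qed.

End Componentwise.

(** * Dickson's lemma and minimal monomials *)

Section MinimalGenerators.
Variable n : nat.
Implicit Types (u v w m : 'X_{1..n}) (s : seq 'X_{1..n}) (P : 'X_{1..n} -> Prop).

Lemma lepm_anti u v : (u <= v)%MM -> (v <= u)%MM -> u = v.
Proof.
move=> /mnm_lepP le_uv /mnm_lepP le_vu; apply/mnmP=> i.
by apply/eqP; rewrite eqn_leq le_uv le_vu.
Qed.

Lemma lepm_mdeg u v : (u <= v)%MM -> (mdeg u <= mdeg v)%N.
Proof. by move=> /submK <-; rewrite mdegD leq_addl. Qed.

Lemma lepm_eq_mdeg u v : (u <= v)%MM -> (mdeg v <= mdeg u)%N -> u = v.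
Proof.
move=> /submK e; rewrite -{1}e mdegD -{2}[mdeg u]add0n leq_add2r leqn0 mdeg_eq0.
by move/eqP=> e0; rewrite -e e0 add0m.
Qed.

(** Dickson's lemma, by induction on the number [k] of exponents compared. *)
Lemma dickson_below k P : exists s, (forall u, u \in s -> P u) /\
  forall m, P m -> exists2 u, u \in s & forall i : 'I_n, (i < k)%N -> (u i <= m i)%N.
Proof.
elim: k P => [|k IH] P.
  have [[m Pm]|noP] := classic (exists m, P m).
    exists [:: m]; split=> [u|v _]; first by rewrite inE => /eqP ->.
    by exists m; rewrite ?mem_head.
  by exists [::]; split=> // m Pm; case: noP; exists m.
have [s [sP s_div]] := IH P; case: (ltnP k n) => [lt_k|le_k]; last first.
  exists s; split=> // m /s_div [u us le_u]; exists u => // i _.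
  by apply: le_u; apply: leq_trans le_k.
pose a := Ordinal lt_k.
have le_a u m : (forall i : 'I_n, (i < k)%N -> (u i <= m i)%N) -> (u a <= m a)%N ->
    forall i : 'I_n, (i < k.+1)%N -> (u i <= m i)%N.
  move=> le_u le_ua i; rewrite ltnS leq_eqVlt => /predU1P [e|/le_u //].
  by have -> : i = a by apply: val_inj.
(* The sum bounds the exponent at [a] of every element of [s], so [s] handles each [m] with [m a] at
   least the sum. Below it, the induction hypothesis is applied to each slice [m a = N]. *)
have [s' [s'P s'_div]] : exists s', (forall u, u \in s' -> P u) /\
    forall m, P m -> (m a < \sum_(u <- s) u a)%N ->
      exists2 u, u \in s' & forall i : 'I_n, (i < k.+1)%N -> (u i <= m i)%N.
  elim: (\sum_(u <- s) _)%N => [|N [s1 [s1P s1_div]]]; first by exists [::].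
  have [s2 [s2P s2_div]] := IH (fun m => P m /\ m a = N).
  exists (s1 ++ s2); split=> [u|m Pm].
    by rewrite mem_cat => /orP [/s1P|/s2P []].
  rewrite ltnS leq_eqVlt => /predU1P [eN|lt_N]; last first.
    by have [u us le_u] := s1_div m Pm lt_N; exists u; rewrite // mem_cat us.
  have [u us le_u] := s2_div m (conj Pm eN).
  exists u; first by rewrite mem_cat us orbT.
  by apply: le_a => //; rewrite eN; case: (s2P u us) => _ ->.
exists (s ++ s'); split=> [u|m Pm]; first by rewrite mem_cat => /orP [/sP|/s'P].
case: (ltnP (m a) (\sum_(u <- s) u a)) => [lt_m|ge_m].
  by have [u us le_u] := s'_div m Pm lt_m; exists u; rewrite // mem_cat us orbT.
have [u us le_u] := s_div m Pm; exists u; first by rewrite mem_cat us.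
apply: le_a => //; apply: leq_trans ge_m.
by rewrite (big_rem u) //= leq_addr.
Qed.

(** What is minimal in the finite list from Dickson's lemma is minimal in all of [P]; descent on the
    degree finds such an element below any [m]. *)
Lemma minimal_elements P : exists s, [/\ uniq s, sorted (keyle mdeg) s,
  forall m, m \in s -> P m /\ forall v, P v -> (v <= m)%MM -> v = m
  & forall m, P m -> exists2 u, u \in s & (u <= m)%MM].
Proof.
have [s [sP s_below]] := dickson_below n P.
have s_div m : P m -> exists2 u, u \in s & (u <= m)%MM.
  by move=> /s_below [u us le_u]; exists u => //; apply/mnm_lepP=> i; apply: le_u.
pose minl m := all (fun u => (u <= m)%MM ==> (u == m)) s.
exists (sort (keyle mdeg) [seq m <- undup s | minl m]).
have memE m : (m \in sort (keyle mdeg) [seq m <- undup s | minl m]) = minl m && (m \in s).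
  by rewrite mem_sort mem_filter mem_undup.
split.
- by rewrite sort_uniq filter_uniq ?undup_uniq.
- by apply: sort_sorted; apply: keyle_total.
- move=> m; rewrite memE => /andP [/allP min_m ms]; split=> [|v Pv le_v]; first exact: sP.
  have [u us le_u] := s_div v Pv; apply: lepm_anti => //.
  have := min_m u us; rewrite (lepm_trans le_u le_v) => /eqP <- //.
move=> m; have [d] := ubnP (mdeg m); elim: d m => // d IH m lt_m Pm.
have [u us le_u] := s_div m Pm; case: (boolP (minl u)) => [min_u|].
  by exists u; rewrite // memE min_u.
case/allPn=> v vs; rewrite negb_imply => /andP [le_vu ne_vu].
have [|x xs le_x] := IH v _ (sP v vs); last first.
  by exists x; rewrite // (lepm_trans le_x) // (lepm_trans le_vu).
have := leq_trans (lepm_mdeg le_u) (lt_m : (mdeg m <= d)%N); apply: leq_trans.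
by rewrite ltnNge; apply: contra ne_vu => /(lepm_eq_mdeg le_vu) ->.
Qed.

End MinimalGenerators.

(** * Spread words and stable moves *)

Section Spread.
Variables (n t : nat).
Implicit Types (u v w m : 'X_{1..n}) (p q r : seq 'I_n) (E : 'X_{1..n} -> Prop).

Definition gap (i j : 'I_n) := (i <= j)%N && (t <= j - i)%N.

(** Makes [sorted gap] equivalent to [pairwise gap], so that words can be cut and reassembled. *)
Lemma gap_trans : transitive gap.
Proof.
move=> j i k /andP [le_ij gap_ij] /andP [le_jk gap_jk].
by rewrite /gap (leq_trans le_ij le_jk) (leq_trans gap_jk) // leq_sub2l.
Qed.

Definition mnm_seq (r : seq 'I_n) : 'X_{1..n} := (\sum_(i <- r) U_(i))%MM.

Lemma mnm_seq_cons i r : mnm_seq (i :: r) = (U_(i) + mnm_seq r)%MM.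
Proof. exact: big_cons. Qed.

Lemma mnm_seq_cat p r : mnm_seq (p ++ r) = (mnm_seq p + mnm_seq r)%MM.
Proof. exact: big_cat. Qed.

Lemma mdeg_mnm_seq r : mdeg (mnm_seq r) = size r.
Proof.
elim: r => [|i r IH]; first by rewrite /mnm_seq big_nil mdeg0.
by rewrite mnm_seq_cons mdegD mdeg1 IH.
Qed.

Lemma mnm_seqE r i : mnm_seq r i = count_mem i r.
Proof.
elim: r => [|j r IH]; first by rewrite /mnm_seq big_nil mnm0E.
by rewrite mnm_seq_cons mnmDE IH mnm1E.
Qed.

Lemma mnm_seq_exchange p i j r :
  mnm_seq (p ++ i :: r) = (U_(i) + (mnm_seq (p ++ j :: r) - U_(j)))%MM.
Proof.
rewrite !mnm_seq_cat !mnm_seq_cons.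
rewrite (_ : mnm_seq p + (U_(j) + _) = mnm_seq p + mnm_seq r + U_(j))%MM.
  by rewrite addmK addmA [(_ + U_(i))%MM]addmC addmA.
by rewrite [(U_(j) + _)%MM]addmC addmA.
Qed.

Lemma pairwise_replace p i j r q :
  pairwise gap (p ++ i :: r) -> pairwise gap (p ++ j :: q) -> all (gap i) q ->
  pairwise gap (p ++ i :: q).
Proof.
rewrite !pairwise_cat !allrel_consr /=.
by case/and3P=> /andP [-> _] -> _ /and3P [/andP [_ ->] _ /andP [_ ->]] ->.
Qed.

Lemma gap_le (i j k : 'I_n) : (i <= j)%N -> gap j k -> gap i k.
Proof.
move=> le_ij /andP [le_jk gap_jk].
by rewrite /gap (leq_trans le_ij le_jk) (leq_trans gap_jk) // leq_sub2l.
Qed.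

Definition tstable E := forall u, tspread t u -> E u ->
  forall j i : 'I_n, (0 < u j)%N -> (i < j)%N ->
    tspread t (U_(i) + (u - U_(j)))%MM -> E (U_(i) + (u - U_(j)))%MM.

(* Two spread words are compared letter by letter, [r] being the unread part of
   [u] and [q] that of [w].  As long as the letter of [w] is the smaller one it
   replaces the letter of [u], which stability allows; so either a prefix of [w]
   lies in [E], or some letter [l] of [u] is smaller than its counterpart [j]
   in [w] and can replace it. *)
Lemma spread_compare E u p r q : tstable E ->
  pairwise gap (p ++ r) -> pairwise gap (p ++ q) -> (size r <= size q)%N ->
  E (mnm_seq (p ++ r)) -> (u <= mnm_seq (p ++ r))%O ->
  {in r, forall i l : 'I_n, (i <= l)%N -> (mnm_seq (p ++ r) l <= u l)%N} ->
  let w := mnm_seq (p ++ q) in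
  (E (mnm_seq (p ++ take (size r) q)) /\ (u <= mnm_seq (p ++ take (size r) q))%O)
  \/ exists l j : 'I_n, [/\ (l < j)%N, (w l < u l)%N, (0 < w j)%N
       & tspread t (U_(l) + (w - U_(j)))%MM].
Proof.
move=> stab; elim: r p q => [|i r IH] p q sp_r sp_q.
  by rewrite take0 => _ Er le_u _ /=; left.
case: q sp_q => // j q sp_q le_rq E_r le_u bound w.
have tspreadP x : pairwise gap x -> tspread t (mnm_seq x).
  by rewrite -(sorted_pairwise gap_trans); exists x.
have tail_le x k y : pairwise gap (p ++ k :: x) -> y \in x -> gap k y.
  by rewrite pairwise_cat => /and3P [_ _] /= /andP [/allP h _] /h.
case: (ltnP i j) => [lt_ij|le_ji].
  right; exists i, j; split=> //.
  (* From [j] on, all letters of [w] are larger than [i], so [w] contains [i] less often than the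
     current word, hence than [u] by [bound]. *)
  - apply: leq_trans (bound i (mem_head _ _) i (leqnn _)).
    rewrite !mnm_seqE !count_cat /= eqxx ltn_add2l -val_eqE gtn_eqF // add0n.
    rewrite (count_memPn _) //; apply: contraTN lt_ij => /(tail_le _ _ _ sp_q).
    by case/andP; rewrite leqNgt.
  - by rewrite mnm_seqE count_cat /= eqxx addnA addnAC addn1.
  - rewrite -mnm_seq_exchange; apply: tspreadP.
    apply: (pairwise_replace sp_r sp_q); apply/allP=> y /(tail_le _ _ _ sp_q).
    exact/gap_le/ltnW.
(* Now [j <= i]. Putting [j] for [i] is a stable move, or no change if they agree, and never lowers
   the word in the monomial order. *)
rewrite /w /= -!cat_rcons.
have sp_jr : pairwise gap (p ++ j :: r).
  apply: (pairwise_replace sp_q sp_r); apply/allP=> y /(tail_le _ _ _ sp_r).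
  exact: gap_le.
have e_jr := mnm_seq_exchange p j i r.
have i_pos : (0 < mnm_seq (p ++ i :: r) i)%N.
  by rewrite mnm_seqE count_cat /= eqxx addnA addnAC addn1.
apply: IH; rewrite ?cat_rcons // {w}.
- case: (eqVneq i j) => [<- //|ne_ij].
  rewrite e_jr; apply: stab => //; first exact: tspreadP.
    by rewrite ltn_neqAle le_ji eq_sym val_eqE ne_ij.
  by rewrite -e_jr; apply: tspreadP.
- apply: le_trans le_u _; case: (eqVneq i j) => [<- //|ne_ij].
  by rewrite e_jr ltW // exchange_gt // ltn_neqAle le_ji eq_sym val_eqE ne_ij.
(* [bound] persists: since [j <= i <= l], the new letter counts at [l] only if [j = i = l], and then
   [i] already counted. *)
move=> k kr l le_kl; have /andP [le_ik _] := tail_le _ _ _ sp_r kr.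
have le_il := leq_trans le_ik le_kl.
apply: leq_trans (bound i (mem_head _ _) l le_il).
rewrite !mnm_seqE !count_cat /= leq_add2l leq_add2r.
case: (eqVneq j l) le_il le_ji => // -> le_il le_li.
by rewrite (_ : i = l) ?eqxx //; apply/val_inj/eqP; rewrite eqn_leq le_il.
Qed.

End Spread.

(** * Passage from stable monomial sets to the two properties of the ideal *)

Section Main.
Variables (K : fieldType) (n t : nat).
Local Notation S := {mpoly K[n]}.
Implicit Types (u v w m : 'X_{1..n}) (E : 'X_{1..n} -> Prop).

Lemma tstable_linquots E s : tstable t E -> uniq s -> sorted (keyle mdeg) s ->
  {in s, forall m, [/\ tspread t m, E m & forall v, E v -> (v <= m)%MM -> v = m]} ->
  (forall m, E m -> exists2 u, u \in s & (u <= m)%MM) ->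
  linquots s.
Proof.
move=> stab s_uniq s_sorted min_s s_div r lt_r u uT.
have us := mem_take uT; have take_s := mem_take_keylt s_uniq s_sorted lt_r.
have ws : nth 0%MM s r \in s by apply: mem_nth.
move: uT; rewrite take_s //; set w := nth _ _ _ in ws take_s * => lt_uw.
have [[x sp_x eu] Eu _] := min_s u us; have [sp_w Ew min_w] := min_s w ws.
have [y sp_y ew] := sp_w; rewrite -/(mnm_seq x) in eu; rewrite -/(mnm_seq y) in ew.
rewrite (sorted_pairwise (@gap_trans n t)) in sp_x.
rewrite (sorted_pairwise (@gap_trans n t)) in sp_y.
have le_deg : (mdeg u <= mdeg w)%N by case/orP: lt_uw => [/ltnW|/andP [/eqP ->]].
have le_xy : (size x <= size y)%N by rewrite -!mdeg_mnm_seq -eu -ew.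
have cmp := @spread_compare n t E u [::] x y stab sp_x sp_y le_xy.
rewrite !cat0s -eu -ew in cmp.
have {cmp} [[Ez le_uz]|] := cmp Eu (lexx _) (fun i _ l _ => leqnn _).
  (* A prefix [z] of [w] in [E] is [w] itself by minimality; then [u] and [w] have equal degree and
     [u <= w], against [u] preceding [w]. *)
  set z := mnm_seq _ in Ez le_uz.
  have le_zw : (z <= w)%MM.
    by rewrite ew -(cat_take_drop (size x) y) mnm_seq_cat lem_addr.
  have ezw := min_w z Ez le_zw.
  move: lt_uw; rewrite /keylt -ezw ltNge le_uz andbF orbF eu !mdeg_mnm_seq.
  by rewrite size_takel // ltnn.
move=> [l [j [lt_lj lt_l w_j sp_v]]].
have [v vs le_v] := s_div _ (stab w sp_w Ew j l w_j lt_lj sp_v).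
exists l => //; apply/hasP; exists v; last first.
  apply: lepm_trans le_v _; apply/mnm_lepP=> i.
  by rewrite !mnmDE leq_add2l mnmBE leq_subr.
(* Either [v] has smaller degree than [w], or [v] is the exchanged monomial, which is larger than
   [w]. *)
rewrite take_s // /keylt -(mdeg_exchange l w_j).
case: (ltngtP (mdeg v)) (lepm_mdeg le_v) => // e _.
by rewrite (lepm_eq_mdeg le_v) ?e // exchange_gt.
Qed.

Lemma linquots_ideal (I : S -> Prop) s :
  uniq s -> {in s &, forall u v, (u <= v)%MM -> u = v} -> linquots s ->
  same_ideal I (mon_ideal (fun m => m \in s)) -> has_linear_quotients I.
Proof.
move=> s_uniq anti lq defI; exists s.
  split=> // s' sub defI' m ms.
  have /mon_idealX [u us' le_u] : mon_ideal (fun m => m \in s') ('X_[m] : S).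
    by apply/defI'/defI/mon_idealX; exists m; rewrite ?lepm_refl.
  by rewrite -(anti u m (sub u us') ms le_u).
move=> r /andP [_ lt_r].
exists [set l | has (fun v => (v <= U_(l) + nth 0%MM s r)%MM) (take r s)] => p.
rewrite (linquot_colon _ (lq r lt_r)); split; apply: ideal_gen_min;
  try exact: ideal_gen_ideal.
  move=> _ [_ /mapP [l + ->] ->]; rewrite mem_filter => /andP [hl _].
  by apply: ideal_gen_sub; exists l; rewrite ?inE.
move=> _ [l + ->]; rewrite inE => hl.
apply: ideal_gen_sub; exists U_(l)%MM => //.
by rewrite map_f // mem_filter hl mem_enum.
Qed.

(** A form lies in [I] exactly when the monomials of its support do, so [degree_part k s] generates
    the degree [k] component. *)
Lemma linquots_componentwise (I : S -> Prop) s :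
  linquots s -> sorted (keyle mdeg) s ->
  same_ideal I (mon_ideal (fun m => m \in s)) -> componentwise_linear I.
Proof.
move=> lq s_sorted defI.
have IE p : I p <-> forall m, m \in msupp p -> divby s m.
  rewrite defI mon_idealP; split=> h m /h; first by case=> u us le_u; apply/hasP; exists u.
  by case/hasP=> u us le_u; exists u.
split.
  split.
    have [I0 ID IM] := ideal_gen_ideal (fun p => exists2 m, m \in s & p = 'X_[m] :> S).
    split; first exact/defI.
      by move=> p q /defI Ip /defI Iq; apply/defI/ID.
    by move=> p q /defI Iq; apply/defI/IM.
  move=> p d /IE Ip; apply/IE => m; rewrite pihomogE => /msupp_sum_le.
  case/flattenP=> _ /mapP [m' + ->] /msuppZ_le; rewrite msuppX mem_filter.
  by rewrite inE => /andP [_ /Ip div_m'] /eqP ->.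
move=> k.
have deg_k w : w \in degree_part k s -> mdeg w = k.
  by rewrite mem_degree_part => /andP [/eqP].
have [|N [eps [heps res gen]]] := @linquots_lin_gens K n k (degree_part k s) deg_k.
  apply: degree_part_linquots => // r lt_r u uT.
  have us := mem_take uT; rewrite in_take // in uT.
  have refl v : keyle mdeg v v by rewrite /keyle eqxx.
  have iu : (index u s < size s)%N by rewrite index_mem.
  have := sorted_leq_nth (@keyle_trans n mdeg) refl 0%MM s_sorted _ _ iu lt_r (ltnW uT).
  by rewrite nth_index // => /predU1P [->//|/orP [/ltnW|/andP [/eqP ->]]].
apply: linres_linear_resolution heps res _ => p; rewrite -gen.
split; apply: ideal_gen_min; try exact: ideal_gen_ideal.
  move=> q [Iq hq]; apply/mon_idealP=> m hm; exists m; rewrite ?lepm_refl //.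
  by rewrite mem_degree_part (dhomog_mf hq hm) eqxx; move/IE: Iq; apply.
move=> _ [m + ->]; rewrite mem_degree_part => /andP [deg_m div_m].
apply: ideal_gen_sub; split; last by rewrite dhomogX.
by apply/IE=> m'; rewrite msuppX inE => /eqP ->.
Qed.

End Main.

Theorem theorem1p4 (K : fieldType) (n t : nat) (I : {mpoly K[n]} -> Prop) :
  tspread_strongly_stable t I ->
  has_linear_quotients I /\ componentwise_linear I.
Proof.
case=> -[M M_spread defI] stab.
pose E m := I 'X_[m].
have EP m : E m <-> exists2 u, M u & (u <= m)%MM by rewrite /E defI mon_idealX.
have [s [s_uniq s_sorted min_s s_div]] := minimal_elements E.
have defIs : same_ideal I (mon_ideal (fun m => m \in s)).
  move=> p; rewrite defI !mon_idealP; split=> h m /h [u].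
    move=> Mu le_u; have [v vs le_v] : exists2 v, v \in s & (v <= u)%MM.
      by apply: s_div; apply/EP; exists u; rewrite ?lepm_refl.
    by exists v; rewrite // (lepm_trans le_v).
  case/min_s=> /EP [v Mv le_v] _ le_u; exists v => //; exact: lepm_trans le_u.
have lq : linquots s.
  apply: (@tstable_linquots n t E) => //.
  move=> m /min_s [Em min_m]; split=> //.
  (* A minimal monomial of [I] equals the element of [M] dividing it, hence is spread. *)
  have /EP [u Mu le_u] := Em; rewrite -(min_m u) //; first exact: M_spread.
  by apply/EP; exists u; rewrite ?lepm_refl.
split; last exact: linquots_componentwise lq s_sorted defIs.
by apply: linquots_ideal defIs => // u v /min_s [Eu _] /min_s [_ min_v]; apply: min_v.
Qed.
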